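(* Consider the homogeneous model in which $\lambda_j(\mathbf{x})=a(w_j-x_j)e^{b\sum_{i=1}^dx_i}$, $j=1,\dots,d$, with the same constant $a>0$ for all groups and $b\ge0$ (with $d\ge1$ arbitrary; $d=1$ gives the one-dimensional model). Put $\tilde\lambda(y)=a(1-y)e^{by}$, so that $\sum_{i=1}^d\lambda_i(\mathbf{x})=\tilde\lambda\big(\sum_{i=1}^dx_i\big)$, and assume that the event is rare, i.e. $\int_0^z\frac{dy}{\tilde\lambda(y)}>T$. Let $c$ be the solution of $$\int_0^z\frac{dy}{\tilde\lambda(y)+c}=T,\qquad c>-\inf_{0\le y\le z}\tilde\lambda(y).$$ Then the importance sampling estimator $\widehat p_n$ of $p_n=\mathbb{P}\big(\sum_{j=1}^dX^n_j(T)\ge z\big)$ based on the sampling jump intensities $$\bar\lambda_j(\mathbf{x})=\lambda_j(\mathbf{x})\Big(1+\frac{c}{\sum_{i=1}^d\lambda_i(\mathbf{x})}\Big),\quad j=1,\dots,d,\ \mathbf{x}\in D\setminus D_z,$$ is asymptotically optimal, i.e. $$\limsup_{n\to\infty}\frac1n\log E_{\bar{\mathbb{Q}}^n}\big[\widehat p_n^{\,2}\big]\le-2U(0,0).$$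
   Context: Setting. Let $d\ge1$, let $w_1,\dots,w_d>0$ with $w_1+\dots+w_d=1$, and let $n$ range over the positive integers such that $nw_j\in\mathbb{N}$ for all $j$ (the $w_j$ are such that there are infinitely many such $n$). Let $D=[0,w_1]\times\dots\times[0,w_d]$, let $z\in(0,1)$, $T\in(0,\infty)$, and $D_z=\{\mathbf{y}\in D:\sum_{j=1}^d y_j\ge z\}$. Let $\mathbf{e}_j$ be the $j$th standard basis vector of $\mathbb{R}^d$. Process. Under $\mathbb{P}$, $X^n$ is the continuous-time pure jump Markov process on $D\cap \frac1n\mathbb{Z}^d$ with $X^n(0)=0$ which jumps from $\mathbf{x}$ to $\mathbf{x}+\mathbf{e}_j/n$ at rate $n\lambda_j(\mathbf{x})$. Let $0=T_0<T_1<T_2<\dots$ be the jump times, let $v_k\in\{\mathbf{e}_1,\dots,\mathbf{e}_d\}$ be the direction of the $k$th jump, and set $N^z=\inf\{k\ge1:X^n(T_k)\in D_z\}$, $N^0=\inf\{k\ge1:T_k>T\}$ (if there is no $k$th jump, $T_k=\infty$). Thus $p_n=\mathbb{P}(N^z<N^0)$. Importance sampling estimator. Under $\bar{\mathbb{Q}}^n$, $X^n$ starts at $0$ and, until it enters $D_z$, jumps from $\mathbf{x}$ to $\mathbf{x}+\mathbf{e}_j/n$ at rate $n\bar\lambda_j(\mathbf{x})$ (its behaviour after entering $D_z$ is irrelevant). One sample of the estimator is $$\widehat p_n=I\{N^z<N^0\}\,\frac{d\mathbb{P}}{d\bar{\mathbb{Q}}^n},$$ where $d\mathbb{P}/d\bar{\mathbb{Q}}^n$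 is the likelihood ratio of the path of $X^n$ up to time $T_{N^z}$: $$\frac{d\mathbb{P}}{d\bar{\mathbb{Q}}^n}=\exp\Big\{\int_0^{T_{N^z}} n\sum_{j=1}^d\big(\bar\lambda_j(X^n(s))-\lambda_j(X^n(s))\big)ds+\sum_{k=1}^{N^z}\log\frac{\lambda_{(k)}(X^n(T_{k-1}))}{\bar\lambda_{(k)}(X^n(T_{k-1}))}\Big\},$$ where $(k)$ denotes the index $j$ with $v_k=\mathbf{e}_j$. $E_{\bar{\mathbb{Q}}^n}$ is expectation under $\bar{\mathbb{Q}}^n$. Rate. For $\mathbf{x}\in D$ and $\beta\in[0,\infty)^d$ let $L(\mathbf{x},\beta)=\sum_{j=1}^d\big(\beta_j\log\frac{\beta_j}{\lambda_j(\mathbf{x})}-\beta_j+\lambda_j(\mathbf{x})\big)$ (with $0\log0=0$, and $+\infty$ if $\beta_j>0=\lambda_j(\mathbf{x})$), and $$U(t,\mathbf{x})=\inf_\psi\Big\{\int_t^TL(\psi(s),\psi'(s))\,ds:\ \psi(t)=\mathbf{x},\ \psi(T)\in D_z\Big\},$$ with infimum over absolutely continuous $D$-valued paths $\psi$ that are non-decreasing in each component. $0$ also denotes the origin of $\mathbb{R}^d$. *)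

(* Defs.v *)
From mathcomp Require Import all_boot all_order all_algebra.
From mathcomp Require Import all_classical all_reals all_analysis.
From mathcomp Require Import measurable_realfun.

Set Implicit Arguments.
Unset Strict Implicit.
Unset Printing Implicit Defensive.
Import Order.TTheory GRing.Theory Num.Theory.
Import numFieldNormedType.Exports.
Local Open Scope classical_set_scope.
Local Open Scope ring_scope.

Definition box (R : realType) (d : nat) (w : 'I_d -> R) : set 'rV[R]_d :=
  [set x | forall j, 0 <= x ord0 j <= w j].

Definition target (R : realType) (d : nat) (w : 'I_d -> R) (z : R) :
    set 'rV[R]_d :=
  [set x | box w x /\ z <= \sum_j x ord0 j].

Definition intensity (R : realType) (d : nat) := 'rV[R]_d -> 'I_d -> R.

Definition homogeneous_intensity (R : realType) (d : nat) (w : 'I_d -> R)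
    (a b : R) : intensity R d :=
  fun x j => a * (w j - x ord0 j) * expR (b * \sum_i x ord0 i).

Definition total_intensity (R : realType) (a b : R) (y : R) : R :=
  a * (1 - y) * expR (b * y).

Definition sampling_intensity (R : realType) (d : nat) (lam : intensity R d)
    (c : R) : intensity R d :=
  fun x j => lam x j * (1 + c / \sum_i lam x i).

(* [jump_time k] is +oo if there is no [k]-th jump.  Jumps are numbered from 1:
   the values of [jump_dir] at 0 and at indices [k] with [jump_time k = +oo]
   carry no meaning. *)
Record trajectory (R : realType) (d : nat) := Trajectory {
  jump_time : nat -> \bar R;
  jump_dir : nat -> 'I_d;
  position : R -> 'rV[R]_d }.

Definition position_after (R : realType) (d : nat) (p : trajectory R d)
    (k : nat) : 'rV[R]_d :=
  position p (fine (jump_time p k)).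

(* [jump_time p k < jump_time p k.+1] is required only for finite
   [jump_time p k], the strict inequality being impossible at +oo. *)
Record is_jump_trajectory (R : realType) (d : nat) (w : 'I_d -> R) (n : nat)
    (p : trajectory R d) : Prop := {
  jump_time0 : jump_time p 0 = 0%E;
  jump_time_nondecreasing :
    forall k, (jump_time p k <= jump_time p k.+1)%E;
  jump_time_increasing :
    forall k, (jump_time p k < +oo -> jump_time p k < jump_time p k.+1)%E;
  position_start : position p 0 = 0;
  position_box : forall t, 0 <= t -> box w (position p t);
  position_constant :
    forall k t, (jump_time p k <= t%:E < jump_time p k.+1)%E ->
      position p t = position_after p k;
  position_jump :
    forall k, (jump_time p k.+1 < +oo)%E ->
      position_after p k.+1 =
        position_after p k + n%:R^-1 *: delta_mx ord0 (jump_dir p k.+1) }.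

(* State reached from the origin after jumps in directions [e 0],..,[e k.-1]. *)
Definition lattice_state (R : realType) (d : nat) (n : nat) (e : nat -> 'I_d)
    (k : nat) : 'rV[R]_d :=
  \sum_(i < k) n%:R^-1 *: delta_mx ord0 (e i).

(* Under [Q], [X] is the pure jump Markov process on the box which starts at the
   origin and, until it enters [A], jumps from [x] to [x + e_j / n] at rate
   [n * lam x j].  The law is given by the jump chain and the holding times: in
   a state [x] with total rate [q x], the holding time is exponential with
   parameter [q x] and, independently of it, the jump has direction [j] with
   probability [n * lam x j / q x], both conditionally on the past.  The jump
   [e i] leaves the [i]-th visited state and is the jump number [i.+1].  Nothing
   is required of the rates of jumps out of [A]. *)
Record is_jump_process (R : realType) (d : nat) (w : 'I_d -> R) (n : nat)
    (lam : intensity R d) (A : set 'rV[R]_d)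
    (disp : measure_display) (Om : measurableType disp)
    (Q : probability Om R) (X : Om -> trajectory R d) : Prop := {
  process_trajectory : forall om, is_jump_trajectory w n (X om);
  process_measurable_time :
    forall k, measurable_fun setT (fun om => jump_time (X om) k);
  process_measurable_dir :
    forall k j, measurable [set om | jump_dir (X om) k = j];
  process_measurable_position :
    forall t j, 0 <= t ->
      measurable_fun setT (fun om => position (X om) t ord0 j);
  process_law :
    forall (k : nat) (e : nat -> 'I_d) (s : nat -> R),
      let x := lattice_state R n e in
      let q i := \sum_j n%:R * lam (x i) j in
      (forall i, (i < k)%N -> 0 <= s i) ->
      (forall i, (i < k)%N -> box w (x i) /\ ~ A (x i)) ->
      Q [set om | forall i, (i < k)%N ->
           jump_dir (X om) i.+1 = e i /\
           ((s i)%:E < jump_time (X om) i.+1 - jump_time (X om) i < +oo)%E] =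
      (\prod_(i < k)
         (n%:R * lam (x i) (e i) / q i * expR (- (q i * s i))))%:E }.

(* The extended-natural-number valued indices N^z and N^0; the infimum of the
   empty set is +oo. *)
Definition first_index (R : realType) (P : set nat) : \bar R :=
  ereal_inf [set (k%:R)%:E | k in [set k | (1 <= k)%N /\ P k]].

Definition entrance_index (R : realType) (d : nat) (w : 'I_d -> R) (z : R)
    (p : trajectory R d) : \bar R :=
  first_index R [set k | (jump_time p k < +oo)%E /\
                         target w z (position_after p k)].

Definition horizon_index (R : realType) (d : nat) (T : R)
    (p : trajectory R d) : \bar R :=
  first_index R [set k | (T%:E < jump_time p k)%E].

(* dP/dQ along the trajectory up to its [N]-th jump, where [lam] and [lamb] are
   the intensities under P and Q. *)
Definition likelihood_ratio (R : realType) (d : nat) (n : nat)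
    (lam lamb : intensity R d) (N : nat) (p : trajectory R d) : R :=
  expR (\int[lebesgue_measure]_(s in `[0, fine (jump_time p N)])
           (n%:R * \sum_j (lamb (position p s) j - lam (position p s) j))
        + \sum_(1 <= k < N.+1)
            ln (lam (position_after p k.-1) (jump_dir p k) /
                lamb (position_after p k.-1) (jump_dir p k))).

(* When N^z < N^0, the index N^z is finite and [truncn (fine _)] is its value as
   a natural number. *)
Definition estimator (R : realType) (d : nat) (w : 'I_d -> R) (z T : R)
    (n : nat) (lam lamb : intensity R d) (p : trajectory R d) : R :=
  if (entrance_index w z p < horizon_index T p)%E then
    likelihood_ratio n lam lamb (Num.truncn (fine (entrance_index w z p))) p
  else 0.

Definition abs_continuous (R : realType) (t T : R) (f : R -> R) : Prop :=
  forall eps : R, 0 < eps -> exists2 delta : R, 0 < delta &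
    forall (m : nat) (l r : 'I_m -> R),
      (forall i, [/\ t <= l i, l i <= r i & r i <= T]) ->
      trivIset setT (fun i => `]l i, r i[%classic) ->
      \sum_i (r i - l i) < delta ->
      \sum_i `|f (r i) - f (l i)| < eps.

(* The summand of L; the first two cases are the conventions [0 log 0 = 0] and
   [+oo] if [beta > 0 = lam]. *)
Definition local_cost (R : realType) (lam beta : R) : \bar R :=
  if beta == 0 then lam%:E
  else if lam == 0 then +oo%E
  else (beta * ln (beta / lam) - beta + lam)%:E.

Definition cost (R : realType) (d : nat) (lam : intensity R d)
    (x : 'rV[R]_d) (beta : 'I_d -> R) : \bar R :=
  (\sum_j local_cost (lam x j) (beta j))%E.

Record admissible_path (R : realType) (d : nat) (w : 'I_d -> R) (z t T : R)
    (x : 'rV[R]_d) (psi : R -> 'rV[R]_d) : Prop := {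
  path_start : psi t = x;
  path_end : target w z (psi T);
  path_box : forall s, t <= s <= T -> box w (psi s);
  path_monotone : forall j r s, t <= r -> r <= s -> s <= T ->
    psi r ord0 j <= psi s ord0 j;
  path_abs_continuous : forall j,
    abs_continuous t T (fun s => psi s ord0 j) }.

(* An admissible path is differentiable almost everywhere on [[t, T]]; on the
   remaining null set the value of [derive1] is irrelevant. *)
Definition value_function (R : realType) (d : nat) (w : 'I_d -> R)
    (lam : intensity R d) (z T t : R) (x : 'rV[R]_d) : \bar R :=
  ereal_inf
    [set (\int[lebesgue_measure]_(s in `[t, T])
            cost lam (psi s) (fun j => derive1 (fun r => psi r ord0 j) s))%E
    | psi in admissible_path w z t T x].

Definition admissible_size (R : realType) (d : nat) (w : 'I_d -> R) : set nat :=
  [set n | (0 < n)%N /\ forall j, n%:R * w j \is a Num.nat].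

(* Main.v *)
Require Import Defs.
From mathcomp Require Import all_boot all_order all_algebra.
From mathcomp Require Import all_classical all_reals all_analysis.
From mathcomp Require Import measurable_realfun.
From mathcomp Require Import ring lra.

Set Implicit Arguments.
Unset Strict Implicit.
Unset Printing Implicit Defensive.
Import Order.TTheory GRing.Theory Num.Theory.
Import numFieldNormedType.Exports.
Local Open Scope classical_set_scope.
Local Open Scope ring_scope.

(** Write [y] for the sum of the coordinates of the state.  Since the total
    intensity is [tlam y] and the sampling intensities are the original ones
    multiplied by [1 + c / tlam y], each jump from level [y] contributes the
    factor [(1 + c / tlam y)^-1] to the likelihood ratio, whatever its direction,
    and the integral term is at most [n c T] on the event [N^z < N^0].  As the
    levels visited before the target are [k / n < z], the estimator is bounded
    pathwise by [exp (n (c T - I) + O(1))] with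
    [I = \int_0^z ln (1 + c / tlam y) dy], a Riemann sum.  On the other hand the path [s |-> y s *: w] with
    [y' = tlam y + c], which reaches [z] exactly at time [T] by the choice of
    [c], has cost [I - c T], so that [U(0, 0) <= I - c T]. *)

(** * Integrals and the mean value theorem *)

(** The integral of a nonnegative function is a supremum over the simple functions below it, and
    those below [f] are below [g]. This serves for the estimator and for the integrand of the
    likelihood ratio. *)
Lemma ge0_le_integral_nonmeasurable (d : measure_display) (T : measurableType d)
    (R : realType) (mu : {measure set T -> \bar R}) (D : set T)
    (f g : T -> \bar R) :
  (forall x, D x -> 0 <= f x)%E -> (forall x, D x -> f x <= g x)%E ->
  (\int[mu]_(x in D) f x <= \int[mu]_(x in D) g x)%E.
Proof.
move=> f0 fg; have g0 x : D x -> (0 <= g x)%E.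
  by move=> Dx; exact: le_trans (f0 _ Dx) (fg _ Dx).
rewrite (ge0_integralE _ f0) (ge0_integralE _ g0).
apply: ge_ereal_sup => _ [h hf <-]; apply: ereal_sup_ubound; exists h => //= x.
apply: le_trans (hf x) _; rewrite /patch; case: ifPn => // /set_mem; exact: fg.
Qed.

Lemma ler_of_is_derive_ge0 (R : realType) (f df : R -> R) (x y : R) :
  x <= y -> (forall t, x <= t <= y -> is_derive t 1 f (df t)) ->
  (forall t, x <= t <= y -> 0 <= df t) -> f x <= f y.
Proof.
rewrite le_eqVlt => /predU1P[->//|xy] fdf df0.
have [t /[!in_itv]/= txy e] : exists2 t, t \in `]x, y[%R & f y - f x = df t * (y - x).
  apply: (@MVT _ f df) => // [t /[!in_itv]/= /andP[xt ty]|].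
    by apply: fdf; rewrite !ltW.
  apply: derivable_within_continuous => t /[!in_itv]/= txy.
  by apply: ex_derive; exact: fdf.
rewrite -subr_ge0 e mulr_ge0 ?subr_ge0 ?(ltW xy)//; apply: df0.
by case/andP: txy => /ltW-> /ltW->.
Qed.

Lemma ler_dist_of_is_derive (R : realType) (f df : R -> R) (M x y : R) :
  x <= y -> (forall t, x <= t <= y -> is_derive t 1 f (df t)) ->
  (forall t, x <= t <= y -> `|df t| <= M) -> `|f y - f x| <= M * (y - x).
Proof.
move=> xy fdf dfM.
have idM (t : R) : is_derive t 1 (fun t : R => M * t) M.
  by apply: is_derive_eq; rewrite /GRing.scale/= !(mulr0, mulr1, addr0).
rewrite ler_norml; apply/andP; split.
- have h : f x + M * x <= f y + M * y.
    apply: (@ler_of_is_derive_ge0 _ (f + (fun t => M * t)) (fun t => df t + M) _ _ xy).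
    + by move=> t txy; have := fdf t txy => ?; exact: is_deriveD.
    + by move=> t /dfM; rewrite ler_norml => /andP[]; lra.
  lra.
- have h : M * x - f x <= M * y - f y.
    apply: (@ler_of_is_derive_ge0 _ ((fun t => M * t) - f) (fun t => M - df t) _ _ xy).
    + by move=> t txy; have := fdf t txy => ?; exact: is_deriveB.
    + by move=> t /dfM; rewrite ler_norml => /andP[]; lra.
  lra.
Qed.

(** The integral from [a] has a two-sided derivative at interior points; it is therefore applied
    below on intervals that strictly contain [[0, z]]. *)
Lemma antiderivative_exists (R : realType) (f : R -> R) (a b : R) :
  (forall x, a <= x <= b -> {for x, continuous f}) ->
  exists F : R -> R, forall x, a < x < b -> is_derive x 1 F (f x).
Proof.
move=> cf; exists (fun x => \int[lebesgue_measure]_(t in `[a, x]) f t).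
move=> x /andP[ax xb].
have [||dF F'] := @continuous_FTC1_closed _ f a x b xb _ ax.
- apply: continuous_compact_integrable; first exact: segment_compact.
  apply: continuous_in_subspaceT => y /set_mem /=; rewrite in_itv/=; exact: cf.
- by apply: cf; rewrite !ltW.
- by apply: DeriveDef; [exact: dF|rewrite -derive1E; exact: F'].
Qed.

Lemma integral_is_derive (R : realType) (f F : R -> R) (a b : R) : a < b ->
  (forall x, a <= x <= b -> {for x, continuous f}) ->
  (forall x, a <= x <= b -> is_derive x 1 F (f x)) ->
  (\int[lebesgue_measure]_(x in `[a, b]) (f x)%:E)%E = (F b - F a)%:E.
Proof.
move=> ab cf dF; rewrite EFinB; apply: continuous_FTC2 => //.
- apply: continuous_in_subspaceT => y /set_mem /=; rewrite in_itv/=; exact: cf.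
- have cF x : a <= x <= b -> {for x, continuous F}.
    move=> /dF ?; apply: differentiable_continuous.
    by apply/derivable1_diffP; exact: ex_derive.
  split.
  + move=> x /[!in_itv]/= /andP[/ltW ax /ltW xb]; apply: ex_derive.
    by apply: dF; rewrite ax xb.
  + by apply: cvg_at_right_filter; apply: cF; rewrite lexx ltW.
  + by apply: cvg_at_left_filter; apply: cF; rewrite lexx ltW.
- move=> x /[!in_itv]/= /andP[/ltW ax /ltW xb]; rewrite derive1E.
  by apply: derive_val; apply: dF; rewrite ax xb.
Qed.

(** * Autonomous differential equations and Riemann sums *)

(** Separation of variables: an antiderivative [H] of [1 / f] is strictly increasing, and [y] is the
    inverse of [x |-> H x - H 0], the time needed to go from [0] to [x]. *)
Lemma autonomous_ode_solution (R : realType) (f : R -> R) (lo hi z T : R) :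
  lo < 0 -> 0 < z -> z < hi ->
  (forall x, lo <= x <= hi -> {for x, continuous f}) ->
  (forall x, lo <= x <= hi -> 0 < f x) ->
  \int[lebesgue_measure]_(x in `[0, z]) (f x)^-1 = T ->
  exists y : R -> R, [/\ y 0 = 0, y T = z &
    forall s, 0 <= s <= T -> 0 <= y s <= z /\ is_derive s 1 y (f (y s))].
Proof.
move=> lo0 z0 zhi cf f0 intf.
have cfV x : lo <= x <= hi -> {for x, continuous (fun x => (f x)^-1)}.
  by move=> xb; apply: continuousV; [rewrite gt_eqF// f0|exact: cf].
have [H dH] := antiderivative_exists cfV.
have inH x : 0 <= x <= z -> lo < x < hi.
  by move=> /andP[x0 xz]; rewrite (lt_le_trans lo0 x0) (le_lt_trans xz zhi).
have HT : H z - H 0 = T.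
  have int_fV :
      (\int[lebesgue_measure]_(x in `[0%R, z]) (f x)^-1%:E)%E = (H z - H 0)%:E.
    apply: integral_is_derive => // x /inH /andP[lx xh].
    - by apply: cfV; rewrite !ltW.
    - by apply: dH; rewrite lx xh.
  by rewrite -intf /Rintegral int_fV.
have H_lt x y : lo < x < hi -> lo < y < hi -> x < y -> H x < H y.
  move=> /andP[lx xh] /andP[ly yh] xy.
  have [t /[!in_itv]/= /andP[xt ty] e] :
      exists2 t, t \in `]x, y[%R & H y - H x = (f t)^-1 * (y - x).
    apply: (@MVT _ H (fun x => (f x)^-1)) => // [t /[!in_itv]/= /andP[xt ty]|].
      by apply: dH; rewrite (lt_trans lx xt) (lt_trans ty yh).
    apply: derivable_within_continuous => t /[!in_itv]/= /andP[xt ty].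
    by apply: ex_derive; apply: dH; rewrite (lt_le_trans lx xt) (le_lt_trans ty yh).
  rewrite -subr_gt0 e mulr_gt0 ?subr_gt0// invr_gt0 f0//.
  by rewrite (ltW (lt_trans lx xt)) (ltW (lt_trans ty yh)).
have H_inj x y : lo < x < hi -> lo < y < hi -> H x = H y -> x = y.
  move=> xI yI Hxy; case: (ltgtP x y) => // [/(H_lt _ _ xI yI)|/(H_lt _ _ yI xI)];
  by rewrite Hxy ltxx.
(* The unique preimage in []lo, hi[]; the default [0] is taken only where there is none. *)
pose y s := xget 0 [set x | lo < x < hi /\ H x = s + H 0].
have yP s : (exists x, lo < x < hi /\ H x = s + H 0) ->
  lo < y s < hi /\ H (y s) = s + H 0 by move=> ex; exact: (xgetPex 0 ex).
have yH x : lo < x < hi -> y (H x - H 0) = x.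
  move=> xI; have [|yI] := yP (H x - H 0); first by exists x; rewrite subrK.
  by rewrite subrK; exact: H_inj.
(* Inverse function theorem: as []lo, hi[] is open, the inverse relation and continuity hold near
   [x], also when [x] is [0] or [z]. *)
have dy x : lo < x < hi -> is_derive (H x - H 0) 1 y (f x).
  move=> xI; rewrite -[f x]invrK.
  have xI' : x \in `]lo, hi[%R by rewrite in_itv.
  have dG (t : R) : lo < t < hi -> is_derive t 1 (fun t => H t - H 0) (f t)^-1.
    move=> /dH ?; apply: is_derive_eq; exact: subr0.
  apply: (@is_derive_inverse _ (fun t => H t - H 0)).
  - by near=> t; apply: yH; near: t; exact: near_in_itvoo.
  - near=> t; apply: differentiable_continuous; apply/derivable1_diffP.
    by apply: ex_derive; apply: dG; near: t; exact: near_in_itvoo.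
  - exact: dG.
  - have /andP[lx xh] := xI.
    by rewrite invr_eq0 gt_eqF// f0// !ltW.
exists y; split=> [||s sT].
- by rewrite -[in LHS](subrr (H 0)) yH// inH// lexx ltW.
- by rewrite -HT yH// inH// lexx ltW.
- have z0' := ltW z0.
  (* This [x] is [y s]; taking it from the intermediate value theorem on [[0, z]] gives the range of
     [y]. *)
  have [x xz Hx] : exists2 x, x \in `[0, z]%R & H x = s + H 0.
    apply: IVT => //.
      apply: derivable_within_continuous => t /[!in_itv]/= /inH tI.
      by apply: ex_derive; exact: dH.
    move: sT; rewrite -HT => /andP[s0 sT].
    by rewrite ge_min lerDr s0 /= le_max -[_ <= H z]lerBrDr sT orbT.
  have xI : lo < x < hi by apply: inH; move: xz; rewrite in_itv.
  have sE : s = H x - H 0 by rewrite Hx addrK.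
  by rewrite sE yH//; split; [move: xz; rewrite in_itv|exact: dy].
Unshelve. all: by end_near. Qed.

(** On a cell of length at most [1 / n] starting at [k / n], the Lipschitz bound gives
    [f <= f (k / n) + L / n]; the increments of [F] over the cells are then summed. *)
Lemma integral_le_riemann_sum (R : realType) (F f : R -> R) (z L : R) (n N : nat) :
  0 <= z -> (forall x, 0 <= x <= z -> is_derive x 1 F (f x)) ->
  (forall x, 0 <= x <= z -> 0 <= f x) ->
  (forall x y, 0 <= x -> x <= y -> y <= z -> `|f y - f x| <= L * (y - x)) ->
  0 <= L -> (0 < n)%N ->
  (forall k, (k < N)%N -> k%:R / n%:R < z) -> z <= N%:R / n%:R ->
  F z - F 0 <= \sum_(k < N) (f (k%:R / n%:R) + L / n%:R) / n%:R.
Proof.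
move=> z0 dF f0 fL L0 n0 ltz zN; have nR0 : 0 < n%:R :> R by rewrite ltr0n.
have nV0 : 0 <= n%:R^-1 :> R by rewrite invr_ge0 ltW.
(* The last grid point may lie beyond [z], where nothing is known of [F], so the cells are cut at
   [z]. *)
suff partial_sum M : (M <= N)%N -> F (Num.min (M%:R / n%:R) z) - F 0 <=
    \sum_(k < M) (f (k%:R / n%:R) + L / n%:R) / n%:R.
  by have := partial_sum N (leqnn N); rewrite (min_idPr zN).
elim: M => [_|M IH MN].
  by rewrite big_ord0 mul0r (min_idPl z0) subrr.
rewrite big_ord_recr/=; have Mz := ltz _ MN.
move: (IH (ltnW MN)); rewrite (min_idPl (ltW Mz)).
set x := M%:R / n%:R in Mz *; set y := Num.min _ _ => {}IH.
have x0 : 0 <= x by rewrite mulr_ge0.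
have xSn : M.+1%:R / n%:R = x + n%:R^-1 by rewrite -natr1 mulrDl mul1r.
have xy : x <= y by rewrite le_min (ltW Mz) xSn lerDl nV0.
have yz : y <= z by rewrite ge_min lexx orbT.
have yx : y - x <= n%:R^-1 by rewrite lerBlDl -xSn ge_min lexx.
have fx0 : 0 <= f x by apply: f0; rewrite x0 ltW.
have : `|F y - F x| <= (f x + L / n%:R) * (y - x).
  apply: (@ler_dist_of_is_derive _ F f) => // t /andP[xt ty].
    by apply: dF; rewrite (le_trans x0 xt) (le_trans ty yz).
  have tz := le_trans ty yz.
  rewrite ger0_norm; last by apply: f0; rewrite (le_trans x0 xt) tz.
  have := fL _ _ x0 xt tz; rewrite ler_norml => /andP[_].
  have : L * (t - x) <= L / n%:R by rewrite ler_wpM2l//; lra.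
  lra.
(* The bound on [f] is nonnegative, so a cut cell may be charged its full length. *)
have : (f x + L / n%:R) * (y - x) <= (f x + L / n%:R) / n%:R.
  by apply: ler_wpM2l => //; rewrite addr_ge0// mulr_ge0.
have := ler_norm (F y - F x); lra.
Qed.

Lemma is_derive1_continuous (R : realType) (f : R -> R) (x df : R) :
  is_derive x 1 f df -> {for x, continuous f}.
Proof.
by move=> ?; apply: differentiable_continuous; apply/derivable1_diffP;
   exact: ex_derive.
Qed.

(** * The total intensity and the logarithm of the tilting factor *)

Lemma total_intensity_gt0 (R : realType) (a b y : R) :
  0 < a -> y < 1 -> 0 < total_intensity a b y.
Proof.
by move=> a0 y1; rewrite /total_intensity !mulr_gt0 ?expR_gt0// subr_gt0.
Qed.

Lemma is_derive_total_intensity (R : realType) (a b x : R) : x < 1 ->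
  is_derive x 1 (total_intensity a b) (total_intensity a b x * (b - (1 - x)^-1)).
Proof.
move=> x1; have x1' : 1 - x != 0 by rewrite gt_eqF// subr_gt0.
have dexp : is_derive x 1 (fun y : R => expR (b * y)) (expR (b * x) * b).
  apply: (@is_derive1_comp _ expR ( *%R b) x _ b).
  by apply: is_derive_eq; rewrite /GRing.scale/= !(mulr0, mulr1, addr0).
rewrite /total_intensity; apply: is_derive_eq.
by rewrite /GRing.scale/=; field.
Qed.

(** The logarithm of sampling over original intensity at level [y], common to all directions. Its
    integral over [[0, z]] is the constant [I]. *)
Definition log_ratio (R : realType) (a b c y : R) : R :=
  ln (1 + c / total_intensity a b y).

(** The second factor equals [- c / (tlam x + c)], which has absolute value at most 1; in this form
    the Lipschitz constant can be read off from the first factor. *)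
Lemma is_derive_log_ratio (R : realType) (a b c x : R) :
  0 < a -> 0 < c -> x < 1 ->
  is_derive x 1 (log_ratio a b c)
    ((b - (1 - x)^-1) * (total_intensity a b x / (total_intensity a b x + c) - 1)).
Proof.
move=> a0 c0 x1; have t0 := total_intensity_gt0 b a0 x1.
have dt := is_derive_total_intensity a b x1.
have tn0 : total_intensity a b x != 0 by rewrite gt_eqF.
have dV : is_derive x 1 (fun y => 1 + c / total_intensity a b y)
    (- c * (b - (1 - x)^-1) / total_intensity a b x).
  apply: is_derive_eq; rewrite /GRing.scale/=; field; rewrite tn0 /=.
  by rewrite gt_eqF// subr_gt0.
rewrite /log_ratio.
have u0 : 0 < 1 + c / total_intensity a b x by rewrite addr_gt0// divr_gt0.
have tc0 : total_intensity a b x + c != 0 by rewrite gt_eqF// addr_gt0.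
have x1' : 1 - x != 0 by rewrite gt_eqF// subr_gt0.
have dln := is_derive1_ln u0.
have := @is_derive1_comp _ (@ln R) (fun y => 1 + c / total_intensity a b y) x _ _ dln dV.
move=> /is_derive_eq; apply.
by field; rewrite tn0 x1' tc0.
Qed.

Lemma log_ratio_ge0 (R : realType) (a b c y : R) :
  0 < a -> 0 < c -> y < 1 -> 0 <= log_ratio a b c y.
Proof.
move=> a0 c0 y1; apply: ln_ge0; rewrite lerDl divr_ge0 ?(ltW c0)//.
by rewrite ltW// total_intensity_gt0.
Qed.

Lemma log_ratio_lipschitz (R : realType) (a b c z x y : R) :
  0 < a -> 0 <= b -> 0 < c -> z < 1 -> 0 <= x -> x <= y -> y <= z ->
  `|log_ratio a b c y - log_ratio a b c x| <= (b + (1 - z)^-1) * (y - x).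
Proof.
move=> a0 b0 c0 z1 x0 xy yz; apply: ler_dist_of_is_derive => // t /andP[xt ty].
  by apply: is_derive_log_ratio => //; lra.
have tz := le_trans ty yz; have t1 := le_lt_trans tz z1.
have := total_intensity_gt0 b a0 t1; set u := total_intensity _ _ _ => u0.
rewrite normrM -[leRHS]mulr1 ler_pM//.
- rewrite (le_trans (ler_normB _ _))// !ger0_norm ?invr_ge0 ?subr_ge0 ?(ltW t1)//.
  by rewrite lerD2l lef_pV2 ?posrE ?subr_gt0// lerD2l lerN2.
- have -> : u / (u + c) - 1 = - (c / (u + c)) by field; rewrite gt_eqF// addr_gt0.
  have uc0 : 0 < u + c by rewrite addr_gt0.
  by rewrite normrN ger0_norm ?divr_ge0 ?(ltW c0) ?(ltW uc0)// ler_pdivrMr// mul1r lerDr ltW.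
Qed.

Lemma sum_homogeneous_intensity (R : realType) (d : nat) (w : 'I_d -> R)
    (a b : R) (x : 'rV[R]_d) : \sum_j w j = 1 ->
  \sum_j homogeneous_intensity w a b x j = total_intensity a b (\sum_j x ord0 j).
Proof.
move=> w1; rewrite /homogeneous_intensity /total_intensity -mulr_suml -mulr_sumr.
by rewrite sumrB w1.
Qed.

(** If [c <= 0], then [1 / (tlam + c) >= 1 / tlam] on [[0, z]], and the integral defining [c] would
    exceed [T] by rarity. *)
Lemma tilt_gt0 (R : realType) (a b c z T : R) :
  0 < a -> 0 < z < 1 ->
  (forall y, 0 <= y <= z -> 0 < total_intensity a b y + c) ->
  T < \int[lebesgue_measure]_(y in `[0, z]) (total_intensity a b y)^-1 ->
  \int[lebesgue_measure]_(y in `[0, z]) (total_intensity a b y + c)^-1 = T ->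
  0 < c.
Proof.
move=> a0 /andP[z0 z1] tc0 rare c_eq; rewrite ltNge; apply/negP => c0.
have ct y : y <= z -> {for y, continuous (total_intensity a b)}.
  move=> yz; have y1 := le_lt_trans yz z1.
  exact: (is_derive1_continuous (is_derive_total_intensity a b y1)).
have integrable_inv (f : R -> R) : (forall y, 0 <= y <= z -> 0 < f y) ->
    (forall y, 0 <= y <= z -> {for y, continuous f}) ->
    lebesgue_measure.-integrable `[0, z] (EFin \o (fun y => (f y)^-1)).
  move=> f0 cf; apply: continuous_compact_integrable; first exact: segment_compact.
  have cV y : 0 <= y <= z -> {for y, continuous (fun y => (f y)^-1)}.
    by move=> yI; apply: continuousV; [rewrite gt_eqF// f0|exact: cf].
  apply: continuous_in_subspaceT => y /set_mem /=; rewrite in_itv/=; exact: cV.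
have t0 y : 0 <= y <= z -> 0 < total_intensity a b y.
  by move=> /andP[_ yz]; rewrite total_intensity_gt0// (le_lt_trans yz).
suff : \int[lebesgue_measure]_(y in `[0, z]) (total_intensity a b y)^-1 <= T.
  by move/(lt_le_trans rare); rewrite ltxx.
rewrite -c_eq; apply: le_Rintegral => //.
- by apply: integrable_inv => // y /andP[_ /ct].
- apply: (integrable_inv (fun y => total_intensity a b y + c)) => // y /andP[_ /ct] cy.
  by apply: continuousD => //; exact: cst_continuous.
- move=> y /=; rewrite in_itv/= => yI.
  by rewrite lef_pV2 ?posrE ?tc0 ?t0// gerDl.
Qed.

(** * Upper bound for the value function *)

Lemma lipschitz_abs_continuous (R : realType) (f : R -> R) (M t T : R) :
  (forall x y, t <= x -> x <= y -> y <= T -> `|f y - f x| <= M * (y - x)) ->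
  abs_continuous t T f.
Proof.
move=> fM eps eps0; pose K := `|M| + 1.
have K0 : 0 < K by rewrite ltr_wpDl.
exists (eps / K) => [|m l r lr _ sum_lt]; first by rewrite divr_gt0.
apply: (@le_lt_trans _ _ (\sum_i K * (r i - l i))).
  apply: ler_sum => i _; have [tl rl rT] := lr i.
  apply: le_trans (fM _ _ tl rl rT) _; apply: ler_wpM2r; first by rewrite subr_ge0.
  by rewrite (le_trans (ler_norm M))// lerDl.
by rewrite -mulr_sumr mulrC -ltr_pdivlMr.
Qed.

(** For velocity [w * (r + c)] against intensity [w * r] the ratio is [1 + c / r], free of [w], so
    the costs of the coordinates add up through the sum of the weights. *)
Lemma local_cost_proportional (R : realType) (w r c : R) :
  0 < w -> 0 < r -> 0 < c ->
  local_cost (w * r) (w * (r + c)) = (w * ((r + c) * ln (1 + c / r) - c))%:E.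
Proof.
move=> w0 r0 c0; have rc0 : 0 < r + c by exact: addr_gt0.
rewrite /local_cost !mulf_eq0 !gt_eqF//=; congr EFin.
have -> : w * (r + c) / (w * r) = 1 + c / r by field; rewrite !gt_eqF.
ring.
Qed.

(* The optimal path [s |-> y s *: w] follows [y' = tlam y + c]: along it the
   running cost is the derivative of [s |-> F (y s) - c * s]. *)
Lemma value_function_le (R : realType) (d : nat) (w : 'I_d -> R)
    (z T a b c : R) (F : R -> R) :
  (forall j, 0 < w j) -> \sum_j w j = 1 -> 0 < z < 1 -> 0 < T ->
  0 < a -> 0 <= b -> 0 < c ->
  \int[lebesgue_measure]_(y in `[0, z]) (total_intensity a b y + c)^-1 = T ->
  (forall x, 0 <= x <= z -> is_derive x 1 F (log_ratio a b c x)) ->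
  (value_function w (homogeneous_intensity w a b) z T 0 0 <=
    (F z - F 0 - c * T)%:E)%E.
Proof.
move=> w0 w1 /andP[z0 z1] T0 a0 b0 c0 c_eq dF.
pose f x := total_intensity a b x + c.
have df (x : R) : x < 1 -> is_derive x 1 f (total_intensity a b x * (b - (1 - x)^-1)).
  move=> /(is_derive_total_intensity a b) ?; apply: is_derive_eq; exact: addr0.
have cf (x : R) : x < 1 -> {for x, continuous f} by move=> /df /is_derive1_continuous.
have f0 x : x < 1 -> 0 < f x.
  by move=> x1; rewrite addr_gt0// total_intensity_gt0.
have [y [y0 yT ys]] : exists y : R -> R, [/\ y 0 = 0, y T = z &
    forall s, 0 <= s <= T -> 0 <= y s <= z /\ is_derive s 1 y (f (y s))].
  (* The upper end [(1 + z) / 2] lies strictly between [z] and 1, so [f] stays positive. *)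
  apply: (@autonomous_ode_solution _ f (-1) ((1 + z) / 2)) => //.
  - lra.
  - by move=> x /andP[_ xz]; apply: cf; lra.
  - by move=> x /andP[_ xz]; apply: f0; lra.
have yz s : 0 <= s <= T -> 0 <= y s <= z by move=> /ys[].
have dy (s : R) : 0 <= s <= T -> is_derive s 1 y (f (y s)) by move=> /ys[].
have y1 s : 0 <= s <= T -> y s < 1 by move=> /yz /andP[_ /le_lt_trans]; exact.
pose psi s : 'rV[R]_d := \row_j (w j * y s).
have sum_psi s : \sum_j psi s ord0 j = y s.
  by under eq_bigr do rewrite mxE; rewrite -mulr_suml w1 mul1r.
have psi_box s : 0 <= s <= T -> box w (psi s).
  move=> sT j; rewrite mxE; have /andP[ys0 _] := yz _ sT.
  by rewrite mulr_ge0 ?(ltW (w0 j))//= ler_piMr ?(ltW (w0 j))// ltW// y1.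
have TT : 0 <= T <= T by rewrite lexx ltW.
have psi_adm : admissible_path w z 0 T 0 psi.
  split=> //.
  - by apply/rowP => j; rewrite !mxE y0 mulr0.
  - by split; [exact: psi_box|rewrite sum_psi yT].
  - move=> j r s r0 rs sT; rewrite !mxE ler_wpM2l ?(ltW (w0 j))//.
    apply: (@ler_of_is_derive_ge0 _ y (f \o y)) => // t /andP[rt ts] /=.
      by apply: dy; rewrite (le_trans r0 rt) (le_trans ts sT).
    by apply: ltW; apply: f0; apply: y1; rewrite (le_trans r0 rt) (le_trans ts sT).
  (* Since [0 <= y < 1], the speed [tlam y + c] is at most [a * expR b + c]. *)
  - move=> j; apply: (@lipschitz_abs_continuous _ _ (w j * (a * expR b + c))).
    move=> r s r0 rs sT; rewrite !mxE -mulrBr normrM (gtr0_norm (w0 j)) -mulrA.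
    rewrite ler_wpM2l ?(ltW (w0 j))//.
    apply: (@ler_dist_of_is_derive _ y (f \o y)) => // t /andP[rt ts] /=.
      by apply: dy; rewrite (le_trans r0 rt) (le_trans ts sT).
    have tT : 0 <= t <= T by rewrite (le_trans r0 rt) (le_trans ts sT).
    have /andP[yt0 _] := yz _ tT; have yt1 := y1 _ tT.
    rewrite gtr0_norm ?f0// lerD2r /total_intensity -mulrA ler_wpM2l ?(ltW a0)//.
    rewrite -[leRHS]mul1r ler_pM ?expR_ge0 ?subr_ge0 ?(ltW yt1)//.
      by rewrite gerBl.
    by rewrite ler_expR ler_piMr// ltW.
apply: (@le_trans _ _ (\int[lebesgue_measure]_(s in `[0%R, T])
    (cost (homogeneous_intensity w a b) (psi s)
      (fun j => derive1 (fun r => psi r ord0 j) s)))%E).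
  by apply: ereal_inf_lbound; exists psi.
pose phi s := f (y s) * log_ratio a b c (y s) - c.
have cost_phi s : 0 <= s <= T ->
    cost (homogeneous_intensity w a b) (psi s)
      (fun j => derive1 (fun r => psi r ord0 j) s) = (phi s)%:E.
  (* The factor 1 is replaced by the sum of the [w j] to distribute [phi] over the coordinates. *)
  move=> sT; rewrite /cost /phi -[X in X%:E]mul1r -w1 mulr_suml -sumEFin.
  apply: eq_bigr => j _.
  have -> : derive1 (fun r => psi r ord0 j) s = w j * f (y s).
    have -> : (fun r => psi r ord0 j) = (fun r => w j * y r).
      by apply/funext => r; rewrite mxE.
    have dys := dy _ sT.
    by rewrite derive1E; apply: derive_val; apply: is_derive_eq.
  have -> : homogeneous_intensity w a b (psi s) j =
      w j * total_intensity a b (y s).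
    by rewrite /homogeneous_intensity /total_intensity sum_psi mxE; ring.
  by rewrite local_cost_proportional// total_intensity_gt0// y1.
have -> : (\int[lebesgue_measure]_(s in `[0%R, T])
    (cost (homogeneous_intensity w a b) (psi s)
      (fun j => derive1 (fun r => psi r ord0 j) s)))%E =
    (\int[lebesgue_measure]_(s in `[0%R, T]) (phi s)%:E)%E.
  by apply: eq_integral => s /set_mem /=; rewrite in_itv/=; exact: cost_phi.
have -> : F z - F 0 - c * T = (F (y T) - c * T) - (F (y 0) - c * 0).
  by rewrite yT y0; ring.
rewrite le_eqVlt; apply/orP; left; apply/eqP.
apply: (@integral_is_derive _ phi (fun s => F (y s) - c * s)) => // s sT.
- have cy := is_derive1_continuous (dy _ sT).
  apply: continuousB; last exact: cst_continuous.
  apply: continuousM.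
    by apply: (@continuous_comp _ _ _ y f) => //; apply: cf; exact: y1.
  apply: (@continuous_comp _ _ _ y (log_ratio a b c)) => //.
  by apply: is_derive1_continuous; apply: is_derive_log_ratio => //; exact: y1.
- have dFy : is_derive s 1 (F \o y) (log_ratio a b c (y s) * f (y s)).
    by apply: is_derive1_comp; [apply: dF; exact: yz|exact: dy].
  rewrite /phi [f (y s) * _]mulrC.
  apply: (@is_deriveB _ _ _ (F \o y) (fun s => c * s)).
  by apply: is_derive_eq; rewrite /GRing.scale/= !(mulr0, mulr1, addr0).
Qed.

(** * First entrance and the levels of a jump trajectory *)

(** The strict bound excludes the empty set, whose infimum is [+oo]; a nonempty set of naturals
    attains its infimum. *)
Lemma first_index_lt (R : realType) (P : set nat) (x : \bar R) :
  (first_index R P < x)%E ->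
  exists N, [/\ (1 <= N)%N, P N, first_index R P = N%:R%:E &
    forall k, (1 <= k < N)%N -> ~ P k].
Proof.
move=> Px; have exP : exists k, `[< (1 <= k)%N /\ P k >].
  apply: contrapT => nP; move: Px; rewrite /first_index.
  suff -> : [set k | (1 <= k)%N /\ P k] = set0.
    by rewrite image_set0 ereal_inf0 ltNge leey.
  by apply/seteqP; split => // k Pk; apply: nP; exists k; apply/asboolP.
case: (ex_minnP exP) => N /asboolP[N1 PN] Nmin.
exists N; split => //.
- apply/eqP; rewrite eq_le; apply/andP; split.
    by apply: ereal_inf_lbound; exists N.
  apply: le_ereal_inf_tmp => _ [k [k1 Pk] <-].
  by rewrite lee_fin ler_nat; apply: Nmin; apply/asboolP.
- move=> k /andP[k1 kN] Pk; have := Nmin k (asboolT (conj k1 Pk)).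
  by rewrite leqNgt kN.
Qed.

Section jump_trajectory.
Context (R : realType) (d : nat) (w : 'I_d -> R) (n : nat) (p : trajectory R d).
Hypotheses (n_gt0 : (0 < n)%N) (p_jump : is_jump_trajectory w n p).

Lemma jump_time_le k m : (k <= m)%N -> (jump_time p k <= jump_time p m)%E.
Proof.
move=> /subnK <-; elim: (m - k)%N => // i /le_trans; apply.
exact: (jump_time_nondecreasing p_jump).
Qed.

Lemma jump_time_ge0 k : (0 <= jump_time p k)%E.
Proof. by rewrite -(jump_time0 p_jump) jump_time_le. Qed.

Lemma position_after_box k : box w (position_after p k).
Proof. by apply: (position_box p_jump); rewrite fine_ge0// jump_time_ge0. Qed.

(** Each jump adds [1 / n] to exactly one coordinate, so the level depends only on the number of
    jumps and not on their directions. *)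
Lemma sum_position_after k : (jump_time p k < +oo)%E ->
  \sum_j position_after p k ord0 j = k%:R / n%:R.
Proof.
elim: k => [_|k IH kfin].
  rewrite /position_after (jump_time0 p_jump) (position_start p_jump) mul0r.
  by rewrite big1// => j _; rewrite mxE.
rewrite (position_jump p_jump kfin).
under eq_bigr do rewrite mxE.
rewrite big_split/= IH; last by apply: le_lt_trans kfin; exact: jump_time_le.
rewrite (bigD1 (jump_dir p k.+1))//= big1 => [|j jk].
  by rewrite !mxE !eqxx mulr1 addr0 -natr1 mulrDl mul1r.
by rewrite !mxE (negbTE jk) mulr0.
Qed.

(* A jump in direction [j] is possible only if the coordinate [j] has not yet
   reached [w j], for otherwise it would leave the box. *)
Lemma jump_intensity_gt0 (a b : R) k : 0 < a -> (jump_time p k.+1 < +oo)%E ->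
  0 < homogeneous_intensity w a b (position_after p k) (jump_dir p k.+1).
Proof.
move=> a0 kfin; have := position_after_box k.+1 (jump_dir p k.+1).
rewrite (position_jump p_jump kfin) !mxE !eqxx mulr1 => /andP[_ le_w].
rewrite /homogeneous_intensity !mulr_gt0 ?expR_gt0// subr_gt0.
by apply: lt_le_trans le_w; rewrite ltrDl invr_gt0 ltr0n.
Qed.

End jump_trajectory.

(** * Pathwise bound on the estimator *)

Section sampling.
Context (R : realType) (d : nat) (w : 'I_d -> R) (a b c : R).
Hypotheses (w_sum : \sum_j w j = 1) (a_gt0 : 0 < a) (c_gt0 : 0 < c).
Let lam := homogeneous_intensity w a b.
Let lamb := sampling_intensity lam c.

(* The difference vanishes where the total intensity is zero, because there
   [c / 0 = 0]. *)
Lemma sampling_intensity_excess (x : 'rV[R]_d) :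
  0 <= \sum_j (lamb x j - lam x j) <= c.
Proof.
have -> : \sum_j (lamb x j - lam x j) = \sum_j lam x j * (c / \sum_i lam x i).
  by apply: eq_bigr => j _; rewrite /lamb /sampling_intensity; ring.
rewrite -mulr_suml; have [->|S0] := eqVneq (\sum_i lam x i) 0.
  by rewrite mul0r lexx ltW.
by rewrite mulrCA divff// mulr1 lexx ltW.
Qed.

Lemma ln_intensity_ratio (x : 'rV[R]_d) (j : 'I_d) :
  0 < lam x j -> \sum_i x ord0 i < 1 ->
  ln (lam x j / lamb x j) = - log_ratio a b c (\sum_i x ord0 i).
Proof.
move=> l0 x1; rewrite /lamb /sampling_intensity sum_homogeneous_intensity//.
have t0 := total_intensity_gt0 b a_gt0 x1.
have u0 : 0 < 1 + c / total_intensity a b (\sum_i x ord0 i).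
  by rewrite addr_gt0// divr_gt0.
by rewrite invfM mulrA divff ?gt_eqF// mul1r /log_ratio lnV.
Qed.

(** The integrand lies between 0 and [n * c] and the duration is at most [T]; the jump from level
    [k / n] contributes exactly [- log_ratio] at that level. *)
Lemma likelihood_ratio_le (n N : nat) (T : R) (p : trajectory R d) :
  (0 < n)%N -> is_jump_trajectory w n p -> (jump_time p N <= T%:E)%E ->
  (forall k, (k < N)%N -> k%:R / n%:R < 1 :> R) ->
  likelihood_ratio n lam lamb N p <=
    expR (n%:R * (c * T) - \sum_(k < N) log_ratio a b c (k%:R / n%:R)).
Proof.
move=> n0 pj NT kn1; have Nfin : (jump_time p N < +oo)%E.
  by apply: le_lt_trans NT _; rewrite ltry.
have J0 := jump_time_ge0 pj N.
have JE : jump_time p N = (fine (jump_time p N))%:E.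
  by rewrite fineK// ge0_fin_numE.
move: NT J0; rewrite {1 2}JE !lee_fin => NT J0.
rewrite /likelihood_ratio ler_expR; apply: lerD; last first.
  (* Jump [k.+1] leaves the state reached after [k] jumps, hence the shift of index. *)
  rewrite big_add1/= big_mkord -sumrN; apply: ler_sum => k _.
  have fin_k i : (i <= N)%N -> (jump_time p i < +oo)%E.
    by move=> iN; apply: le_lt_trans Nfin; exact: jump_time_le pj _ _ iN.
  have sumE := sum_position_after pj (fin_k _ (ltnW (ltn_ord k))).
  rewrite ln_intensity_ratio ?sumE ?kn1//.
  by apply: (jump_intensity_gt0 _ pj) => //; exact: fin_k.
set J := fine _ in NT J0 *; set f := fun s => n%:R * \sum_j _.
have f_bound s : 0 <= f s <= n%:R * c.
  have /andP[e0 ec] := sampling_intensity_excess (position p s).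
  by rewrite /f mulr_ge0//= ler_wpM2l.
have int_le : (\int[lebesgue_measure]_(s in `[0%R, J]) (f s)%:E <=
    (n%:R * c * J)%:E)%E.
  apply: (@le_trans _ _ (\int[lebesgue_measure]_(s in `[0%R, J])
      (cst (n%:R * c)%:E s))%E).
    by apply: ge0_le_integral_nonmeasurable => s _;
      have /andP[f0 fc] := f_bound s; rewrite lee_fin.
  rewrite integral_cst//= lebesgue_measure_itv/= lte_fin.
  case: ifPn => [_|]; first by rewrite -EFinB subr0 -EFinM.
  by rewrite -leNgt mule0 => _; rewrite lee_fin !mulr_ge0// ltW.
(* Together with the upper bound this makes the integral finite, so that [fine] preserves its
   value. *)
have int_ge0 : (0 <= \int[lebesgue_measure]_(s in `[0%R, J]) (f s)%:E)%E.
  by apply: integral_ge0 => s _; have /andP[f0 _] := f_bound s; rewrite lee_fin.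
rewrite /Rintegral; apply: (@le_trans _ _ (n%:R * c * J)).
  rewrite -lee_fin fineK// ge0_fin_numE//.
  by apply: le_lt_trans int_le _; rewrite ltry.
by rewrite mulrA ler_wpM2l// mulr_ge0// ltW.
Qed.

(** The sum of [log_ratio] over the visited levels is [n] times a Riemann sum, and its total error
    [L * N / n] is at most [2 * L], uniformly in [n]. *)
Lemma estimator_bound (n : nat) (z T : R) (F : R -> R) (p : trajectory R d) :
  0 <= b -> 0 < z < 1 ->
  (forall x, 0 <= x <= z -> is_derive x 1 F (log_ratio a b c x)) ->
  (0 < n)%N -> is_jump_trajectory w n p ->
  0 <= estimator w z T n lam lamb p <=
    expR (n%:R * (c * T - (F z - F 0)) + 2 * (b + (1 - z)^-1)).
Proof.
move=> b0 /andP[z0 z1] dF n0 pj; rewrite /estimator.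
case: ifPn => [|_]; last by rewrite lexx expR_ge0.
move=> /[dup] /first_index_lt[N [N1 [Nfin [_ zN]] entN Nmin]].
rewrite /entrance_index entN => lt_horizon; rewrite /= natrK.
have nR0 : 0 < n%:R :> R by rewrite ltr0n.
(* Otherwise [N] would belong to the set defining the horizon index, which would then be at most the
   entrance index. *)
have NT : (jump_time p N <= T%:E)%E.
  rewrite leNgt; apply/negP => TN; move: lt_horizon; rewrite ltNge => /negP; apply.
  by apply: ereal_inf_lbound; exists N.
rewrite (sum_position_after pj Nfin) in zN.
(* Minimality of [N] covers only indices from 1 on; the starting level 0 is below [z] because
   [z > 0]. *)
have kz k : (k < N)%N -> k%:R / n%:R < z.
  case: k => [_|k kN]; first by rewrite mul0r.
  have kfin : (jump_time p k.+1 < +oo)%E.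
    by apply: le_lt_trans Nfin; apply: (jump_time_le pj); exact: ltnW.
  rewrite ltNge -(sum_position_after pj kfin); apply/negP => zk.
  by apply: (Nmin k.+1) => //; split => //; split => //; exact: position_after_box pj _.
apply/andP; split; first by rewrite /likelihood_ratio expR_ge0.
apply: le_trans (likelihood_ratio_le n0 pj NT _) _.
  by move=> k /kz /lt_trans; exact.
rewrite ler_expR.
set L := b + _; have L0 : 0 <= L by rewrite addr_ge0// invr_ge0 subr_ge0 ltW.
have riemann : F z - F 0 <=
    \sum_(k < N) (log_ratio a b c (k%:R / n%:R) + L / n%:R) / n%:R.
  apply: integral_le_riemann_sum (ltW z0) dF _ _ L0 n0 kz zN.
  - by move=> x /andP[_ xz]; apply: log_ratio_ge0 => //; exact: le_lt_trans xz z1.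
  - by move=> x y; exact: log_ratio_lipschitz.
(* The level before the last jump is below [z < 1], and the last jump adds [1 / n <= 1]. *)
have N2 : N%:R / n%:R <= 2 :> R.
  rewrite -(prednK N1) -natr1 mulrDl mul1r (_ : 2 = 1 + 1)//; apply: lerD.
    by apply: ltW; apply: lt_trans z1; apply: kz; rewrite prednK.
  by rewrite invf_le1// ler1n.
move: riemann; rewrite -mulr_suml ler_pdivlMr// big_split/= sumr_const card_ord.
rewrite -[_ *+ N]mulr_natr => riemann.
have : L * (N%:R / n%:R) <= L * 2 by rewrite ler_wpM2l.
have -> : L * (N%:R / n%:R) = L / n%:R * N%:R by ring.
lra.
Qed.

End sampling.

(** * Second moment and asymptotic optimality *)

Theorem mainTheorem2 (R : realType) (d : nat) (w : 'I_d -> R) (z T a b c : R)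
    (disp : nat -> measure_display) (Om : forall n, measurableType (disp n))
    (Q : forall n, probability (Om n) R)
    (X : forall n, Om n -> trajectory R d)
    (lam := homogeneous_intensity w a b)
    (lamb := sampling_intensity lam c)
    (tlam := total_intensity a b)
    (d_ge1 : (1 <= d)%N)
    (w_gt0 : forall j, 0 < w j)
    (w_sum : \sum_j w j = 1)
    (w_sizes : forall m, exists2 n, (m <= n)%N & admissible_size w n)
    (z_itv : 0 < z < 1)
    (T_gt0 : 0 < T)
    (a_gt0 : 0 < a)
    (b_ge0 : 0 <= b)
    (rare : T < \int[lebesgue_measure]_(y in `[0, z]) (tlam y)^-1)
    (c_gt : - inf [set tlam y | y in `[0, z]] < c)
    (c_eq : \int[lebesgue_measure]_(y in `[0, z]) (tlam y + c)^-1 = T)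
    (X_process : forall n, admissible_size w n ->
       is_jump_process w n lamb (target w z) (Q n) (@X n)) :
  (limf_esup
     (fun n : nat => n%:R^-1%:E *
        lne ('E_(Q n)[fun om => (estimator w z T n lam lamb (X n om) ^+ 2)%R]))
     (within (admissible_size w) \oo)
   <= - (2%:E * value_function w lam z T 0 0))%E.
Proof.
have /andP[z0 z1] := z_itv.
have tlam_gt0 y : 0 <= y <= z -> 0 < tlam y.
  by move=> /andP[_ yz]; rewrite total_intensity_gt0// (le_lt_trans yz).
have c_gt0 : 0 < c.
  apply: (tilt_gt0 a_gt0 z_itv _ rare c_eq) => y yz.
  (* The set is bounded below by 0, so its infimum is a true lower bound and [c_gt] gives
     [tlam y + c > 0] on [[0, z]]. *)
  have : inf [set tlam y | y in `[0, z]] <= tlam y.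
    apply: ge_inf; last by exists y => //=; rewrite in_itv.
    by exists 0 => _ [x /= + <-]; rewrite in_itv/= => /tlam_gt0 /ltW.
  by rewrite -/(tlam y); lra.
have [F dF] : exists F : R -> R,
    forall x, 0 <= x <= z -> is_derive x 1 F (log_ratio a b c x).
  have [|F dF] := @antiderivative_exists _ (log_ratio a b c) (-1) ((1 + z) / 2).
    move=> x /andP[_ xz]; apply: is_derive1_continuous.
    by apply: is_derive_log_ratio => //; lra.
  by exists F => x /andP[x0 xz]; apply: dF; lra.
set K := c * T - (F z - F 0); set L := b + (1 - z)^-1.
have L0 : 0 <= L by rewrite addr_ge0// invr_ge0 subr_ge0 ltW.
(* With [K = c * T - I], this is the bound [U(0, 0) <= I - c * T] multiplied by [-2]. *)
have limit_le : ((2 * K)%:E <= - (2%:E * value_function w lam z T 0 0))%E.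
  have := value_function_le w_gt0 w_sum z_itv T_gt0 a_gt0 b_ge0 c_gt0 c_eq dF.
  rewrite leeNr -EFinN => VF.
  apply: (@le_trans _ _ (2%:E * (F z - F 0 - c * T)%:E)%E).
    by apply: lee_wpmul2l => //; rewrite lee_fin.
  by rewrite -EFinM lee_fin /K; lra.
apply: le_trans limit_le; apply/lee_addgt0Pr => e e0.
have log_moment n : admissible_size w n -> 
    (n%:R^-1%:E * lne ('E_(Q n)[fun om => (estimator w z T n lam lamb (X n om) ^+ 2)%R])
     <= (2 * K + 4 * L / n%:R)%:E)%E.
  move=> adm; have [n0 _] := adm; have nR0 : 0 < n%:R :> R by rewrite ltr0n.
  set m := ('E_(_)[_])%E.
  have m_ge0 : (0 <= m)%E.
    by rewrite /m unlock; apply: integral_ge0 => om _; rewrite lee_fin sqr_ge0.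
  (* The pathwise bound is squared and integrated against a probability. *)
  have m_le : (m <= (expR (n%:R * (2 * K) + 4 * L))%:E)%E.
    rewrite /m unlock; apply: (@le_trans _ _ (\int[Q n]_om
        (cst (expR (n%:R * (2 * K) + 4 * L))%:E om))%E).
      apply: ge0_le_integral_nonmeasurable => om _; first by rewrite lee_fin sqr_ge0.
      have /andP[E0 EK] := estimator_bound w_sum a_gt0 c_gt0 T b_ge0 z_itv dF n0
        (process_trajectory (X_process n adm) om).
      have -> : expR (n%:R * (2 * K) + 4 * L) = expR (n%:R * K + 2 * L) ^+ 2.
        by rewrite expr2 -expRD; congr expR; ring.
      by rewrite lee_fin lerXn2r// nnegrE// expR_ge0.
    rewrite integral_cst//.
    by rewrite [X in (_ * X)%E](@probability_setT _ _ _ (Q n)) mule1.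
  apply: (@le_trans _ _ (n%:R^-1%:E * (n%:R * (2 * K) + 4 * L)%:E)%E).
    apply: lee_wpmul2l; rewrite ?lee_fin ?invr_ge0//.
    rewrite -[leRHS]/((n%:R * (2 * K) + 4 * L)%:E) -[X in (_ <= X%:E)%E]expRK -lne_EFin ?expR_gt0//.
    by rewrite lee_lne// !in_itv/= ?andbT ?m_ge0 ?leey ?lee_fin ?expR_ge0.
  rewrite -EFinM lee_fin mulrDr mulKf ?gt_eqF// lerD2l.
  by rewrite mulrC.
(* From [n1] on, the error [4 * L / n] is at most [e]. *)
pose n1 := (Num.truncn (4 * L / e)).+1.
apply: (@le_trans _ _ (ereal_sup [set (n%:R^-1%:E *
    lne ('E_(Q n)[fun om => (estimator w z T n lam lamb (X n om) ^+ 2)%R]))%E |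
    n in [set n | admissible_size w n /\ (n1 <= n)%N]])).
  (* The upper limit is an infimum of suprema over the sets of the filter; the admissible sizes from
     [n1] on form one such set. *)
  apply: ereal_inf_lbound.
  exists [set n | admissible_size w n /\ (n1 <= n)%N] => //.
  by exists n1 => // n /= n1n adm.
apply: ge_ereal_sup => _ [n [adm n1n] <-].
apply: le_trans (log_moment _ adm) _; rewrite -EFinD lee_fin lerD2l.
have nR0 : 0 < n%:R :> R by rewrite ltr0n; case: adm.
rewrite ler_pdivrMr// [leRHS]mulrC -ler_pdivrMr// ltW//.
apply: (@lt_le_trans _ _ n1%:R); last by rewrite ler_nat.
exact: truncnS_gt.
Qed.
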